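(* Let $G=(V,E)$ be a finite simple graph that is both $P_6$-free and banner-free. If $G$ has an efficient dominating set, then the square $G^2$ is banner-free.
   Context: All graphs are finite, undirected and simple. $P_t$ denotes the path on $t$ vertices. For a family $\mathcal{F}$ of graphs, a graph $G$ is $\mathcal{F}$-free if it contains no induced subgraph isomorphic to a member of $\mathcal{F}$. A banner is the graph obtained from a chordless cycle on four vertices by adding one new vertex adjacent to exactly one vertex of the cycle. An efficient dominating set of $G$ is a subset $D\subseteq V$ that is an independent set such that every vertex of $V\setminus D$ has exactly one neighbor in $D$. For vertices $u,v$, $\mathrm{dist}_G(u,v)$ is the distance between them in $G$. The square of $G=(V,E)$ is the graph $G^2=(V,E^2)$ where $uv\in E^2$ if and only if $\mathrm{dist}_G(u,v)\in\{1,2\}$. *)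

(* Defs.v *)
From mathcomp Require Import all_boot.
Set Implicit Arguments. Unset Strict Implicit. Unset Printing Implicit Defensive.

Definition simple_graph (V : finType) (e : rel V) : Prop :=
  symmetric e /\ irreflexive e.

Definition induced_sub (W V : finType) (h : rel W) (e : rel V) : Prop :=
  exists f : W -> V, injective f /\ forall x y, e (f x) (f y) = h x y.

Definition P6_rel : rel 'I_6 :=
  fun i j => (i.+1 == j :> nat) || (j.+1 == i :> nat).

Definition banner_edge (i j : nat) : bool :=
  [|| (i == 0) && (j == 1), (i == 1) && (j == 2), (i == 2) && (j == 3),
      (i == 3) && (j == 0) | (i == 0) && (j == 4)].
Definition banner_rel : rel 'I_5 :=
  fun i j => banner_edge i j || banner_edge j i.

Definition P6_free (V : finType) (e : rel V) : Prop := ~ induced_sub P6_rel e.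
Definition banner_free (V : finType) (e : rel V) : Prop := ~ induced_sub banner_rel e.

Definition efficient_dominating (V : finType) (e : rel V) (D : {set V}) : Prop :=
  (forall x y, x \in D -> y \in D -> ~~ e x y) /\
  (forall v, v \notin D -> #|[set d in D | e v d]| = 1).

(* Square: u v adjacent iff dist_G(u,v) in {1,2}, i.e. u <> v and they are
   adjacent or have a common neighbour. *)
Definition square (V : finType) (e : rel V) : rel V :=
  fun u v => (u != v) && (e u v || [exists w, e u w && e w v]).

(* Main.v *)
Require Import Defs.
From mathcomp Require Import all_boot.

(* Let v0 v1 v2 v3 be an induced 4-cycle of G^2 with a pendant vertex v4 at v0.
   Forbidding P6 and banners (and using v4) shows that consecutive vi are at
   distance exactly 2 and that any midpoint of vi, vi+1 is adjacent to any
   midpoint of vi+1, vi+2.  Let [dom v] be the unique element of D in the closed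
   neighbourhood of v.  An induced P4 or P5 extends to an induced P6 by the
   dominators of its end vertices, unless these coincide or dominate another
   vertex of the path.  Hence the [dom vi] are pairwise distinct, and
   [dom v1 = dom b] or [dom v3 = dom c] for midpoints b of v1, v2 and c of v2, v3,
   and cyclically.  So the dominators of the four midpoints are those of the vi
   in cyclic order, shifted one way or the other, and the same extension
   principle gives a P6. *)

Section Graph.

Variables (V : finType) (e : rel V).
Hypotheses (eC : symmetric e) (eI : irreflexive e).
Hypotheses (P6f : P6_free e) (bannerf : banner_free e).

(** * Forbidden subgraphs given by explicit vertices *)

Lemma no_P6 x0 x1 x2 x3 x4 x5 :
  e x0 x1 -> e x1 x2 -> e x2 x3 -> e x3 x4 -> e x4 x5 ->
  ~~ e x0 x2 -> ~~ e x0 x3 -> ~~ e x0 x4 -> ~~ e x0 x5 ->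
  ~~ e x1 x3 -> ~~ e x1 x4 -> ~~ e x1 x5 ->
  ~~ e x2 x4 -> ~~ e x2 x5 -> ~~ e x3 x5 -> False.
Proof.
move=> e01 e12 e23 e34 e45 /negbTE n02 /negbTE n03 /negbTE n04 /negbTE n05.
move=> /negbTE n13 /negbTE n14 /negbTE n15 /negbTE n24 /negbTE n25 /negbTE n35.
pose f (i : 'I_6) := nth x0 [:: x0; x1; x2; x3; x4; x5] i.
have fE x y : e (f x) (f y) = P6_rel x y.
  rewrite /f; case: x => [[|[|[|[|[|[|//]]]]]] ?];
    case: y => [[|[|[|[|[|[|//]]]]]] ?] //=; rewrite ?eI //;
    by [|rewrite eC].
apply: P6f; exists f; split=> // x y fxy.
(* Injectivity of [f]: distinct vertices of P6 have distinct neighbourhoods. *)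
have rowE z : P6_rel x z = P6_rel y z by rewrite -!fE fxy.
have := rowE (@Ordinal 6 0 isT); have := rowE (@Ordinal 6 1 isT).
have := rowE (@Ordinal 6 2 isT); have := rowE (@Ordinal 6 3 isT).
have := rowE (@Ordinal 6 4 isT); have := rowE (@Ordinal 6 5 isT).
case: x {fxy rowE} => [[|[|[|[|[|[|//]]]]]] ?];
  by case: y => [[|[|[|[|[|[|//]]]]]] ?] // *; apply: val_inj.
Qed.

(* [x1] and [x3] are twins in the banner, so their distinctness does not follow
   from the adjacencies. *)
Lemma no_banner x0 x1 x2 x3 x4 : x1 != x3 ->
  e x0 x1 -> e x1 x2 -> e x2 x3 -> e x3 x0 -> e x0 x4 ->
  ~~ e x0 x2 -> ~~ e x1 x3 -> ~~ e x1 x4 -> ~~ e x2 x4 -> ~~ e x3 x4 -> False.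
Proof.
move=> x13 e01 e12 e23 e30 e04 /negbTE n02 /negbTE n13 /negbTE n14.
move=> /negbTE n24 /negbTE n34.
pose f (i : 'I_5) := nth x0 [:: x0; x1; x2; x3; x4] i.
have fE x y : e (f x) (f y) = banner_rel x y.
  rewrite /f; case: x => [[|[|[|[|[|//]]]]] ?];
    case: y => [[|[|[|[|[|//]]]]] ?] //=; rewrite ?eI //;
    by [|rewrite eC].
apply: bannerf; exists f; split=> // x y fxy.
have rowE z : banner_rel x z = banner_rel y z by rewrite -!fE fxy.
have := rowE (@Ordinal 5 0 isT); have := rowE (@Ordinal 5 1 isT).
have := rowE (@Ordinal 5 2 isT); have := rowE (@Ordinal 5 3 isT).
have := rowE (@Ordinal 5 4 isT); move: fxy {rowE}.
rewrite /f; case: x => [[|[|[|[|[|//]]]]] ?];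
  case: y => [[|[|[|[|[|//]]]]] ?] //= fxy *; try exact: val_inj;
  by rewrite fxy eqxx in x13.
Qed.

(** Distance at least 3, that is, distinct and non-adjacent in the square. *)
Definition far u w := [/\ u != w, ~~ e u w & forall z, e u z -> ~~ e z w].

Lemma far_sym {u w} : far u w -> far w u.
Proof.
move=> [uw nuw far_uw]; split; rewrite 1?eq_sym 1?eC // => z ewz.
by apply/negP; rewrite eC => /far_uw; rewrite eC ewz.
Qed.

Lemma far_edge {u w} : far u w -> ~~ e u w. Proof. by case. Qed.

Lemma far_common {u w z} : far u w -> e w z -> ~~ e u z.
Proof. by case=> _ _ far_uw ewz; apply/negP => /far_uw; rewrite eC ewz. Qed.

Lemma neq_by {z x y} : e x z -> ~~ e y z -> x != y.
Proof. by move=> exz; apply: contraNneq => <-. Qed.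

Lemma nonedge_sym {x y} : ~~ e x y -> ~~ e y x. Proof. by rewrite eC. Qed.

Ltac edge := solve [assumption | rewrite eC; assumption].

Ltac nonedge1 :=
  match goal with
  | H : is_true (~~ e ?x ?y) |- is_true (~~ e ?x ?y) => exact H
  | H : far ?x ?y |- is_true (~~ e ?x ?y) => exact (far_edge H)
  | H : far ?x ?w |- is_true (~~ e ?x ?y) =>
      solve [apply: (far_common H); edge]
  | H : far ?w ?x |- is_true (~~ e ?x ?y) =>
      solve [apply: (far_common (far_sym H)); edge]
  end.

Ltac nonedge := solve [nonedge1 | apply: nonedge_sym; nonedge1].

Ltac distinct :=
  match goal with
  | H : is_true (e ?x ?z) |- is_true (?x != ?y) =>
      solve [apply: (neq_by H); nonedge]
  | H : is_true (e ?z ?x) |- is_true (?x != ?y) =>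
      solve [apply: (@neq_by z); [edge | nonedge]]
  | H : is_true (e ?y ?z) |- is_true (?x != ?y) =>
      solve [rewrite eq_sym; apply: (neq_by H); nonedge]
  | H : is_true (e ?z ?y) |- is_true (?x != ?y) =>
      solve [rewrite eq_sym; apply: (@neq_by z); [edge | nonedge]]
  end.

Ltac adj := first [edge | nonedge | distinct].
Ltac P6 x0 x1 x2 x3 x4 x5 := exfalso; apply: (no_P6 x0 x1 x2 x3 x4 x5); adj.
Ltac banner x0 x1 x2 x3 x4 := exfalso; apply: (no_banner x0 x1 x2 x3 x4); adj.

(** * Midpoints on an induced 4-cycle of the square *)

Definition mid u w m := e u m && e m w.

Lemma midC u w m : mid u w m = mid w u m.
Proof. by rewrite /mid andbC (eC u) (eC w). Qed.

Lemma squareP {u w} : square e u w -> e u w \/ exists m, mid u w m.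
Proof. by move=> /andP[_ /orP[|/existsP[m]]]; [left|right; exists m]. Qed.

Lemma squareC u w : square e u w = square e w u.
Proof.
rewrite /square eq_sym eC; congr (_ && (_ || _)).
by apply: eq_existsb => z; apply: midC.
Qed.

Lemma far_square u w : u != w -> square e u w = false -> far u w.
Proof.
rewrite /square => uw; rewrite uw /= => /negbT; rewrite negb_or.
case/andP => nuw /existsPn noz; split=> // z euz.
by have := noz z; rewrite euz.
Qed.

(** If [v0 v1] were an edge, there would be midpoints [b] of [v1 v2] and [d] of [v3 v0]. Either
    [v3 d v0 v1 b v2] is an induced P6, or the chord [b d] closes a 4-cycle with pendant [v3]. *)
Lemma cycle4_nonedge {v0 v1 v2 v3} :
  square e v1 v2 -> square e v3 v0 -> far v0 v2 -> far v1 v3 -> ~~ e v2 v3 ->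
  ~~ e v0 v1.
Proof.
move=> /squareP s12 /squareP s30 far02 far13 n23; apply/negP => e01.
case: s12 => [e12|[b /andP[e1b eb2]]].
  by have := far_common (far_sym far02) e01; rewrite eC e12.
case: s30 => [e30|[d /andP[e3d ed0]]].
  by have := far_common far13 e30; rewrite eC e01.
have [ebd|nbd] := boolP (e b d); first by banner d v0 v1 b v3.
by P6 v3 d v0 v1 b v2.
Qed.

(** The same argument, with [v4] and a midpoint [p] of [v0 v4] replacing [v3] and [d]. *)
Lemma pendant_nonedge {v0 v1 v2 v4} : square e v1 v2 -> square e v0 v4 ->
  far v0 v2 -> far v4 v1 -> far v4 v2 -> ~~ e v0 v1.
Proof.
move=> /squareP s12 /squareP s04 far02 far41 far42; apply/negP => e01.
case: s12 => [e12|[b /andP[e1b eb2]]].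
  by have := far_common (far_sym far02) e01; rewrite eC e12.
case: s04 => [e04|[p /andP[e0p ep4]]].
  by rewrite eC in e04; have := far_common (far_sym far41) e04; rewrite eC e01.
have [epb|npb] := boolP (e p b); first by banner p v0 v1 b v4.
by P6 v4 p v0 v1 b v2.
Qed.

Definition cycle4 v0 v1 v2 v3 :=
  [/\ [/\ square e v0 v1, square e v1 v2, square e v2 v3 & square e v3 v0],
      [/\ ~~ e v0 v1, ~~ e v1 v2, ~~ e v2 v3 & ~~ e v3 v0],
      far v0 v2 & far v1 v3].

Definition pendant4 v0 v1 v2 v3 v4 :=
  [/\ square e v0 v4, far v4 v1, far v4 v2 & far v4 v3].

(** The pendant vertex settles the two sides at [v0]; [cycle4_nonedge] transfers this to the
    opposite sides. *)
Lemma cycle4_pendant v0 v1 v2 v3 v4 :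
  square e v0 v1 -> square e v1 v2 -> square e v2 v3 -> square e v3 v0 ->
  far v0 v2 -> far v1 v3 -> pendant4 v0 v1 v2 v3 v4 -> cycle4 v0 v1 v2 v3.
Proof.
move=> s01 s12 s23 s30 far02 far13 [s04 far41 far42 far43].
have n01 := pendant_nonedge s12 s04 far02 far41 far42.
have n03 : ~~ e v0 v3.
  by apply: (@pendant_nonedge _ v3 v2 v4) => //; rewrite squareC.
split=> //; split=> //; last by rewrite eC.
  apply: (@cycle4_nonedge _ _ v3 v0) => //; first exact: far_sym.
  by rewrite eC.
by apply: (@cycle4_nonedge _ _ v0 v1) => //; apply: far_sym.
Qed.

Lemma cycle4_rot {v0 v1 v2 v3} : cycle4 v0 v1 v2 v3 -> cycle4 v1 v2 v3 v0.
Proof. by case=> [[? ? ? ?] [? ? ? ?] ? ?]; split=> //; apply: far_sym. Qed.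

Lemma cycle4_rev {v0 v1 v2 v3} : cycle4 v0 v1 v2 v3 -> cycle4 v0 v3 v2 v1.
Proof.
case=> [[? ? ? ?] [? ? ? ?] ? ?].
by split; [split; rewrite squareC|split; rewrite eC| |apply: far_sym].
Qed.

Lemma cycle4_mid {v0 v1 v2 v3} : cycle4 v0 v1 v2 v3 -> exists m, mid v0 v1 m.
Proof. by case=> [[/squareP[->|]]] // _ _ _ []. Qed.

(** Each other combination of [b c] and [a c] gives a banner or a P6. Thus non-adjacency of
    consecutive midpoints propagates around the cycle. *)
Lemma mid_nonadj_next {v0 v1 v2 v3 a b c} : cycle4 v0 v1 v2 v3 ->
  mid v0 v1 a -> mid v1 v2 b -> mid v2 v3 c -> ~~ e a b -> ~~ e b c /\ e a c.
Proof.
move=> C /andP[e0a ea1] /andP[e1b eb2] /andP[e2c ec3] nab.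
case: C => _ [n01 n12 n23 n30] far02 far13.
have [ebc|nbc] := boolP (e b c); have [eac|nac] := boolP (e a c) => //.
- by banner a v1 b c v0.
- by P6 v0 a v1 b c v3.
- by P6 v0 a v1 b v2 c.
Qed.

Lemma mid_adj1 {v0 v1 v2 v3 v4 a b} : cycle4 v0 v1 v2 v3 ->
  pendant4 v0 v1 v2 v3 v4 -> mid v0 v1 a -> mid v1 v2 b -> e a b.
Proof.
move=> C [/squareP s04 far41 far42 far43] ma mb; apply/negPn/negP => nab.
have [c mc] := cycle4_mid (cycle4_rot (cycle4_rot C)).
have [d md] := cycle4_mid (cycle4_rot (cycle4_rot (cycle4_rot C))).
have [nbc eac] := mid_nonadj_next C ma mb mc nab.
have [ncd ebd] := mid_nonadj_next (cycle4_rot C) mb mc md nbc.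
case: C ma mb mc md => _ [n01 n12 n23 n30] far02 far13 /andP[e0a ea1].
move=> /andP[e1b eb2] /andP[e2c ec3] /andP[e3d ed0].
have [e04|n04] := boolP (e v0 v4); first by P6 v4 v0 a c v2 b.
case: s04 => [e04|[p /andP[e0p ep4]]]; first by rewrite e04 in n04.
(* Step by step, [p] must be adjacent to [a], not to [b], and adjacent to [c]; then both options for
   [d] fail. *)
have [epa|npa] := boolP (e p a); last first.
  have [epc|npc] := boolP (e p c); first by banner p v0 a c v4.
  by P6 v4 p v0 a c v2.
have [epb|npb] := boolP (e p b); first by banner p a v1 b v4.
have [epc|npc] := boolP (e p c); last by P6 v4 p a c v2 b.
have [epd|npd] := boolP (e p d); first by banner p d v3 c v4.
by P6 v4 p v0 d b v2.
Qed.

(* The midpoints are quantified over, so that a dominator common to two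
   consecutive vertices can be taken as their midpoint. *)
Definition ring4 v0 v1 v2 v3 :=
  cycle4 v0 v1 v2 v3 /\
  [/\ forall a b, mid v0 v1 a -> mid v1 v2 b -> e a b,
      forall b c, mid v1 v2 b -> mid v2 v3 c -> e b c,
      forall c d, mid v2 v3 c -> mid v3 v0 d -> e c d
    & forall d a, mid v3 v0 d -> mid v0 v1 a -> e d a].

(** [mid_adj1] and its reflection cover the corners [v1] and [v3]. A non-adjacent pair at [v2] or
    [v0] would propagate to one at [v1]. *)
Lemma ring4_pendant v0 v1 v2 v3 v4 : cycle4 v0 v1 v2 v3 ->
  pendant4 v0 v1 v2 v3 v4 -> ring4 v0 v1 v2 v3.
Proof.
move=> C P4; split=> //.
have [a0 ma0] := cycle4_mid C; have [b0 mb0] := cycle4_mid (cycle4_rot C).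
have C2 := cycle4_rot (cycle4_rot C); have C3 := cycle4_rot C2.
split.
- by move=> a b; apply: mid_adj1 C P4.
- move=> b c; rewrite (midC _ _ b) (midC _ _ c) => mb mc.
  apply/negPn; rewrite eC; apply/negP => ncb; move: ma0; rewrite midC => ma0.
  have [] := mid_nonadj_next (cycle4_rot (cycle4_rev C)) mc mb ma0 ncb.
  by rewrite eC (mid_adj1 C P4) // midC.
- have P4' : pendant4 v0 v3 v2 v1 v4 by case: P4.
  move=> c d; rewrite (midC _ _ c) (midC _ _ d) eC => mc md.
  exact: mid_adj1 (cycle4_rev C) P4' md mc.
- move=> d a md ma; apply/negPn/negP => nda.
  have [] := mid_nonadj_next C3 md ma mb0 nda.
  by rewrite (mid_adj1 C P4).
Qed.

Lemma ring4_rot {v0 v1 v2 v3} : ring4 v0 v1 v2 v3 -> ring4 v1 v2 v3 v0.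
Proof. by case=> C [? ? ? ?]; split=> //; apply: cycle4_rot. Qed.

(** * Dominators and the extension of induced paths *)

Variables (D : {set V}) (dom : V -> V).
Hypotheses (domD : forall v, dom v \in D)
  (dom_self : forall v, v \in D -> dom v = v)
  (dom_nbr : forall v, dom v != v -> e v (dom v))
  (dom_uniq : forall v d, d \in D -> e v d -> dom v = d).

Lemma dom_idem v : dom (dom v) = dom v. Proof. exact: dom_self. Qed.

Lemma dom_edge {v w} : e v (dom w) -> dom v = dom w.
Proof. exact: dom_uniq. Qed.

Lemma nonedge_dom {v w} : dom v <> dom w -> ~~ e v (dom w).
Proof. by move=> vw; apply/negP => /dom_edge. Qed.

(** If [v] were its own dominator, it would also dominate its neighbour [w]. *)
Lemma dom_out {v w} : e v w -> dom v <> dom w -> e v (dom v).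
Proof.
move=> evw vw; apply: dom_nbr; apply/eqP => vE; apply: vw.
by rewrite (@dom_edge w v) // vE eC.
Qed.

Lemma dom_shared {v w} :
  e v (dom v) -> ~~ e v w -> dom w = dom v -> e w (dom v).
Proof.
move=> ev nvw wv; rewrite -wv; apply: dom_nbr.
by apply: contraNneq nvw => <-; rewrite wv.
Qed.

(** A common dominator would put [u] and [w] at distance at most 2. *)
Lemma far_dom {u w} : far u w -> dom u <> dom w.
Proof.
case=> uw nuw far_uw uwE.
have [uE|] := eqVneq (dom u) u.
  have [wE|/dom_nbr] := eqVneq (dom w) w; first by rewrite -uE uwE wE eqxx in uw.
  by rewrite -uwE uE eC (negbTE nuw).
move=> /dom_nbr eu; have [wE|/dom_nbr] := eqVneq (dom w) w.
  by rewrite uwE wE (negbTE nuw) in eu.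
by rewrite -uwE eC (negbTE (far_uw _ eu)).
Qed.

(** Prepending [dom u1] gives a P6, since the other vertices have other dominators. *)
Lemma dom_P5 {u1 u2 u3 u4 u5} :
  e u1 u2 -> e u2 u3 -> e u3 u4 -> e u4 u5 ->
  ~~ e u1 u3 -> ~~ e u1 u4 -> ~~ e u1 u5 ->
  ~~ e u2 u4 -> ~~ e u2 u5 -> ~~ e u3 u5 ->
  dom u2 <> dom u1 -> dom u3 <> dom u1 -> dom u4 <> dom u1 -> dom u5 <> dom u1 ->
  False.
Proof.
move=> e12 e23 e34 e45 *; have e1 : e u1 (dom u1).
  by apply: dom_out e12 _; apply/nesym.
apply: (@no_P6 (dom u1) u1 u2 u3 u4 u5) => //; first by rewrite eC.
all: by rewrite eC; apply: nonedge_dom.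
Qed.

(** Both end dominators are added; they are non-adjacent because [D] is independent. *)
Lemma dom_P4 {u1 u2 u3 u4} :
  e u1 u2 -> e u2 u3 -> e u3 u4 -> ~~ e u1 u3 -> ~~ e u1 u4 -> ~~ e u2 u4 ->
  dom u1 <> dom u4 ->
  dom u2 <> dom u1 -> dom u3 <> dom u1 -> dom u2 <> dom u4 -> dom u3 <> dom u4 ->
  False.
Proof.
move=> e12 e23 e34 n13 n14 n24 d14 d21 d31 d24 d34.
have e1 : e u1 (dom u1) by apply: dom_out e12 _; apply/nesym.
have e4 : e u4 (dom u4) by apply: (@dom_out _ u3); [rewrite eC|apply/nesym].
apply: (@no_P6 (dom u1) u1 u2 u3 u4 (dom u4)) => //; try by rewrite eC.
all: try by apply: nonedge_dom; rewrite ?dom_idem.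
all: by rewrite eC; apply: nonedge_dom => //; apply/nesym.
Qed.


(** * Dominators of the corners and midpoints *)

Lemma mid_dom {v0 v1 v2 v3} : cycle4 v0 v1 v2 v3 -> dom v0 = dom v1 ->
  mid v0 v1 (dom v0).
Proof.
case=> [[/andP[v01 _] _ _ _] [n01 _ _ _] _ _] dE; rewrite /mid.
(* A common dominator equal to [v0] or [v1] would make these two equal or adjacent. *)
have [d0|/dom_nbr ->] := eqVneq (dom v0) v0.
  have [d1|/dom_nbr] := eqVneq (dom v1) v1.
    by rewrite -d0 dE d1 eqxx in v01.
  by rewrite -dE d0 eC (negbTE n01).
rewrite eC dE; apply: dom_nbr; apply: contraNneq n01 => d1.
rewrite -d1 -dE; apply: dom_nbr; rewrite dE d1 eq_sym.
exact: v01.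
Qed.

(** A common dominator would be a midpoint of [v1 v2], hence adjacent to [a] and [c] and their
    dominator too. The induced path from [v0] to [v3] through [a] and [c] then extends to a P6. *)
Lemma ring4_dom_neq {v0 v1 v2 v3} : ring4 v0 v1 v2 v3 -> dom v1 <> dom v2.
Proof.
move=> R12 d12; have [C [adj01 adj12 adj23 adj30]] := R12.
have mb := mid_dom (cycle4_rot C) d12.
have C2 := cycle4_rot (cycle4_rot C); have C3 := cycle4_rot C2.
have [a ma] := cycle4_mid C; have [c mc] := cycle4_mid C2.
have eab := adj01 _ _ ma mb; have ebc := adj12 _ _ mb mc.
have da := dom_edge eab; have dc : dom c = dom v1.
  by apply: dom_edge; rewrite eC.
case: (C) => _ [n01 n12 n23 n30] far02 far13.
have d02 := far_dom far02; have d13 := far_dom far13.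
have d03 : dom v0 <> dom v3.
  move=> d30; have := adj23 _ _ mc (mid_dom C3 (esym d30)).
  by move=> /dom_edge; rewrite dc.
move: ma mb mc => /andP[e0a ea1] /andP[e1b eb2] /andP[e2c ec3].
have [eac|nac] := boolP (e a c).
  apply: (@dom_P4 v0 a c v3); try adj; rewrite ?da ?dc //; congruence.
apply: (@dom_P5 v3 c (dom v1) a v0); try adj; rewrite ?dom_idem ?da ?dc //.
all: congruence.
Qed.

(** Otherwise [v1 b c v3] extends by the dominators of its ends, unless [dom v1] sees [c] or
    [dom v3] sees [b], which closes a banner. *)
Lemma dom_opposite {v0 v1 v2 v3 b c} : ring4 v0 v1 v2 v3 ->
  mid v1 v2 b -> mid v2 v3 c -> dom v1 = dom b \/ dom v3 = dom c.
Proof.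
move=> [C [_ adj12 _ _]] mb mc; have ebc := adj12 _ _ mb mc.
case: C mb mc => _ [n01 n12 n23 n30] far02 far13.
move=> /andP[e1b eb2] /andP[e2c ec3]; have d13 := far_dom far13.
have [->|/eqP d1b] := eqVneq (dom v1) (dom b); first by left.
have [->|/eqP d3c] := eqVneq (dom v3) (dom c); first by right.
exfalso.
have e1 : e v1 (dom v1) by apply: dom_out e1b _.
have e3 : e v3 (dom v3) by apply: (@dom_out _ c); rewrite 1?eC.
have n1b : ~~ e b (dom v1) by apply: nonedge_dom; apply/nesym.
have n3c : ~~ e c (dom v3) by apply: nonedge_dom; apply/nesym.
have n31 : ~~ e v3 (dom v1) by apply: nonedge_dom; apply/nesym.
have n13 : ~~ e v1 (dom v3) by apply: nonedge_dom.
have db1 : dom v1 != b by apply/eqP => bE; apply: d1b; rewrite -bE dom_idem.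
have dc3 : dom v3 != c by apply/eqP => cE; apply: d3c; rewrite -cE dom_idem.
have [e1c|n1c] := boolP (e c (dom v1)); first by banner c (dom v1) v1 b v3.
have [e3b|n3b] := boolP (e b (dom v3)); first by banner b (dom v3) v3 c v1.
apply: (@dom_P4 v1 b c v3); (try adj); (try congruence) => dE.
  by apply: (negP n1c); apply: dom_shared e1 _ dE; nonedge.
by apply: (negP n3b); apply: dom_shared e3 _ dE; nonedge.
Qed.

Lemma ring4_false {v0 v1 v2 v3} : ring4 v0 v1 v2 v3 -> False.
Proof.
move=> R; have R1 := ring4_rot R; have R2 := ring4_rot R1.
have R3 := ring4_rot R2.
have [n12 n23 n30 n01] := And4 (ring4_dom_neq R) (ring4_dom_neq R1)
  (ring4_dom_neq R2) (ring4_dom_neq R3).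
have [a ma] := cycle4_mid (proj1 R); have [b mb] := cycle4_mid (proj1 R1).
have [c mc] := cycle4_mid (proj1 R2); have [d md] := cycle4_mid (proj1 R3).
have o1 := dom_opposite R mb mc; have o2 := dom_opposite R1 mc md.
have o3 := dom_opposite R2 md ma; have o0 := dom_opposite R3 ma mb.
have [C [adj01 adj12 adj23 adj30]] := R.
have eab := adj01 _ _ ma mb; have ebc := adj12 _ _ mb mc.
have ecd := adj23 _ _ mc md; have eda := adj30 _ _ md ma.
case: C => _ [m01 m12 m23 m30] far02 far13.
have d02 := far_dom far02; have d13 := far_dom far13.
move: ma mb mc md => /andP[e0a ea1] /andP[e1b eb2] /andP[e2c ec3] /andP[e3d ed0].
(* Each midpoint occurs in two of the four alternatives, with distinct corner dominators, so one
   choice forces all the others. *)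
have [[dE0 dE1 dE2 dE3]|[dE0 dE1 dE2 dE3]] :
    [/\ dom a = dom v0, dom b = dom v1, dom c = dom v2 & dom d = dom v3] \/
    [/\ dom a = dom v1, dom b = dom v2, dom c = dom v3 & dom d = dom v0].
  case: o1 o2 o3 o0 => [?|?] [?|?] [?|?] [?|?];
    first [left; split; congruence | right; split; congruence | congruence].
(* The path starts at [v1] because [a], [c] and [d] have the dominators of [v0], [v2] and [v3]; in
   the shifted case it starts at [v0]. *)
- have [eac|nac] := boolP (e a c).
    by apply: (@dom_P4 v1 a c v3); try adj; congruence.
  by apply: (@dom_P5 v1 a d c v2); try adj; congruence.
have [eac|nac] := boolP (e a c).
  by apply: (@dom_P4 v0 a c v2); try adj; congruence.
by apply: (@dom_P5 v0 a b c v3); try adj; congruence.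
Qed.

End Graph.

(** * From an efficient dominating set to the theorem *)

Lemma efficient_dominator (V : finType) (e : rel V) (D : {set V}) :
  efficient_dominating e D -> exists dom : V -> V,
  [/\ forall v, dom v \in D, forall v, v \in D -> dom v = v,
      forall v, dom v != v -> e v (dom v)
    & forall v d, d \in D -> e v d -> dom v = d].
Proof.
move=> [Dindep D1].
(* Outside [D] the [pick] always succeeds, so the default [v] is never returned. *)
exists (fun v => if v \in D then v else odflt v [pick d in D | e v d]).
have nbr v : v \notin D -> exists d, [set x in D | e v x] = [set d].
  by move=> vD; apply/cards1P; rewrite D1.
split=> [v | v -> // | v | v d dD evd].
- case: ifP => // /negbT /nbr[d dE]; case: pickP => [x /andP[]//|/(_ d)].
  have : d \in [set x in D | e v x] by rewrite dE set11.
  by rewrite inE => ->.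
- by case: ifP => [_|_]; [rewrite eqxx|case: pickP => [x /andP[]|_ /eqP]].
- case: ifP => [vD|/negbT /nbr[x xE]].
    by rewrite (negbTE (Dindep _ _ vD dD)) in evd.
  have inx y : y \in D -> e v y -> y = x.
    by move=> yD evy; apply/set1P; rewrite -xE inE yD.
  case: pickP => [y /andP[yD evy]|/(_ d)]; last by rewrite dD evd.
  by rewrite /= (inx y) // (inx d).
Qed.

Theorem theorem2 (V : finType) (e : rel V) :
  simple_graph e -> P6_free e -> banner_free e ->
  (exists D : {set V}, efficient_dominating e D) ->
  banner_free (square e).
Proof.
move=> [eC eI] P6f bannerf [D /efficient_dominator[dom]].
move=> [domD dom_self dom_nbr dom_uniq] [f [f_inj fE]].
pose v k (lt_k5 : k < 5) := f (Ordinal lt_k5).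
have farf i j : i != j -> banner_rel i j = false -> far V e (f i) (f j).
  by move=> ij nij; apply: far_square; rewrite ?(inj_eq f_inj) // fE.
pose v0 := v 0 isT; pose v1 := v 1 isT; pose v2 := v 2 isT.
pose v3 := v 3 isT; pose v4 := v 4 isT.
have P4 : pendant4 V e v0 v1 v2 v3 v4 by split; rewrite ?fE //; apply: farf.
have C : cycle4 V e v0 v1 v2 v3.
  by apply: cycle4_pendant P4; rewrite ?fE //; apply: farf.
have R := ring4_pendant V e eC eI P6f bannerf _ _ _ _ _ C P4.
by apply: (ring4_false V e eC eI P6f bannerf D dom _ _ _ _ R).
Qed.
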